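(* Let $n\ge 0$ and $j\ge 0$ be integers. The number of permutations $\pi$ of $[n]=\{1,\dots,n\}$ that avoid the barred pattern $\overline{3}\overline{1}542$ and have exactly $j$ left-to-right maxima, all of which initiate a descent in $\pi$, equals $j!\,\left\{ {n-j \atop j} \right\}$, where $\left\{ {m \atop j} \right\}$ denotes the Stirling number of the second kind.
   Context: A permutation $\pi=\pi(1)\cdots\pi(n)$ of $[n]$ avoids the barred pattern $\overline{3}\overline{1}542$ if for all indices $a<b<c$ with $\pi(a)>\pi(b)>\pi(c)$ there exist indices $d<e<a$ with $\pi(e)<\pi(c)<\pi(d)<\pi(b)$. An entry $\pi(i)$ is a left-to-right maximum if $\pi(i)>\pi(h)$ for all $h<i$; it initiates a descent if $i<n$ and $\pi(i)>\pi(i+1)$. The Stirling number of the second kind $\left\{ {m \atop j} \right\}$ is the number of partitions of an $m$-element set into $j$ nonempty blocks, with $\left\{ {0 \atop 0} \right\}=1$ and $\left\{ {m \atop j} \right\}=0$ for $m<0$. *)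

(* Defs.v *)
From mathcomp Require Import all_boot all_order all_fingroup all_algebra.

Set Implicit Arguments.
Unset Strict Implicit.
Unset Printing Implicit Defensive.

(* Permutations of [n] are elements of 'S_n: positions and values are both
   shifted from {1,...,n} to {0,...,n-1}, which preserves all comparisons. *)

(* The unbarred letters 5, 4, 2 are at positions a < b < c, and the barred
   letters 3, 1 at positions d < e. *)
Definition avoids_bar3_bar1_542 n (pi : 'S_n) : bool :=
  [forall a : 'I_n, forall b : 'I_n, forall c : 'I_n,
     [&& a < b, b < c, pi b < pi a & pi c < pi b] ==>
     [exists d : 'I_n, exists e : 'I_n,
        [&& d < e, e < a, pi e < pi c, pi c < pi d & pi d < pi b]]].

Definition lr_max n (pi : 'S_n) (i : 'I_n) : bool :=
  [forall h : 'I_n, (h < i) ==> (pi h < pi i)].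

Definition initiates_descent n (pi : 'S_n) (i : 'I_n) : bool :=
  [exists k : 'I_n, (k == i.+1 :> nat) && (pi k < pi i)].

(* The upper index is an integer so that the convention that the number is 0
   when m < 0 is explicit. [partition] requires the blocks to be nonempty. *)
Definition stirling2 (m : int) (j : nat) : nat :=
  match m with
  | Posz m' =>
      #|[set P : {set {set 'I_m'}} | partition P [set: 'I_m'] & #|P| == j]|
  | Negz _ => 0
  end.

(* Main.v *)
(* Suppose that every left-to-right maximum of s initiates a descent.  Then s
   avoids the barred pattern iff, for any two consecutive left-to-right maxima,
   the values lying strictly between them appear in increasing order: the
   "4" and "2" of a 542 are then separated in value by a left-to-right maximum,
   and the least left-to-right maximum above "2" and the entry following it play
   the barred "3" and "1".

   Consequently, a last entry that is not a left-to-right maximum can be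
   appended exactly when its value sits immediately below an existing
   left-to-right maximum, which gives j choices.  This yields
   f(n+2, j+1) = (j+1) (f(n+1, j+1) + f(n, j)), the recurrence satisfied by
   j! S(n-j, j). *)
Require Import Defs.
From mathcomp Require Import all_boot all_order all_fingroup all_algebra.
From mathcomp Require Import zify.

Set Implicit Arguments.
Unset Strict Implicit.
Unset Printing Implicit Defensive.

(** * Pattern avoidance as separation of inversions by left-to-right maxima *)

Definition inversions_split n (s : 'S_n) : bool :=
  [forall x : 'I_n, forall y : 'I_n,
     [&& x < y, s y < s x & ~~ lr_max s x] ==>
     [exists m : 'I_n, [&& lr_max s m, s y < s m & s m < s x]]].

Lemma lr_maxP n (s : 'S_n) (i : 'I_n) :
  reflect (forall h : 'I_n, h < i -> s h < s i) (lr_max s i).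
Proof.
by apply: (iffP forallP) => H h; [move=> hi; exact: (implyP (H h)) |
  apply/implyP; exact: H].
Qed.

Lemma inversions_splitP n (s : 'S_n) :
  reflect (forall x y : 'I_n, x < y -> s y < s x -> ~~ lr_max s x ->
             exists2 m : 'I_n, lr_max s m & s y < s m < s x)
          (inversions_split s).
Proof.
apply: (iffP forallP) => [H x y xy syx nmx | H x].
  have /existsP[m /and3P[mm ym mx]] := implyP (forallP (H x) y)
    (introT and3P (And3 xy syx nmx)).
  by exists m => //; rewrite ym mx.
apply/forallP => y; apply/implyP => /and3P[xy syx nmx].
have [m mm /andP[ym mx]] := H x y xy syx nmx.
by apply/existsP; exists m; rewrite mm ym mx.
Qed.

Lemma avoidsP n (s : 'S_n) :
  reflect (forall a b c : 'I_n, a < b -> b < c -> s b < s a -> s c < s b ->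
             exists d e : 'I_n,
               [/\ d < e, e < a, s e < s c, s c < s d & s d < s b])
          (avoids_bar3_bar1_542 s).
Proof.
apply: (iffP forallP) => [H a b c ab bc ba cb | H a].
  have /existsP[d /existsP[e /and5P[]]] := implyP (forallP (forallP (H a) b) c)
    (introT and4P (And4 ab bc ba cb)).
  by exists d, e.
apply/forallP => b; apply/forallP => c; apply/implyP => /and4P[ab bc ba cb].
have [d [e [h1 h2 h3 h4 h5]]] := H a b c ab bc ba cb.
by apply/existsP; exists d; apply/existsP; exists e; rewrite h1 h2 h3 h4 h5.
Qed.

Lemma perm_ltn_neq n (s : 'S_n) (x y : 'I_n) :
  x != y -> (s x < s y) || (s y < s x).
Proof. by move=> xy; rewrite -neq_ltn (inj_eq val_inj) (inj_eq perm_inj). Qed.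

(** Take the earliest entry exceeding [v]: everything before it is at most [v], which makes it a
    left-to-right maximum. *)
Lemma first_above n (s : 'S_n) v (x : 'I_n) : v < s x ->
  exists m : 'I_n, [/\ v < s m, lr_max s m &
    forall h : 'I_n, v < s h -> m <= h].
Proof.
move=> vx; case: (@arg_minnP _ x (fun z => v < s z) (@nat_of_ord n) vx).
move=> m vm mmin; exists m; split => //; apply/lr_maxP => h hm.
by rewrite ltnNge; apply/negP => sh; have := mmin h (leq_trans vm sh); lia.
Qed.

Lemma lr_max_mono n (s : 'S_n) (m x : 'I_n) :
  lr_max s x -> m <= x -> s m <= s x.
Proof.
move=> /lr_maxP H; rewrite leq_eqVlt => /orP[/eqP/val_inj -> // | /H]; lia.
Qed.

Lemma avoids_split n (s : 'S_n) :
  avoids_bar3_bar1_542 s -> inversions_split s.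
Proof.
move=> /avoidsP av; apply/inversions_splitP => x y xy syx nmx.
(* The role of 5 goes to the earliest entry exceeding [s x], while [x] and [y] play 4 and 2. *)
have [a [sxa ma amin]] : exists a : 'I_n, [/\ s x < s a, lr_max s a &
    forall h : 'I_n, s x < s h -> a <= h].
  move: nmx; rewrite negb_forall => /existsP[h].
  rewrite negb_imply -leqNgt => /andP[hx xh].
  apply: (@first_above _ _ _ h).
  have := @perm_ltn_neq _ s x h; rewrite -(inj_eq val_inj) /=; lia.
have ax : a < x.
  rewrite ltnNge; apply/negP => xa; have := lr_max_mono ma xa.
  move: nmx; rewrite negb_forall => /existsP[h].
  rewrite negb_imply -leqNgt => /andP[hx xh].
  have := @perm_ltn_neq _ s x h; rewrite -(inj_eq val_inj) /=.
  have := amin h; lia.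
have [d [e [de ea sey syd sdx]]] := av a x y ax xy sxa syx.
(* The earliest entry above [s y] is no later than the barred 3 at [d], hence before [a]. By
   minimality of [a] its value cannot exceed [s x]. *)
have [m [ym mm mmin]] := first_above syd.
exists m => //; rewrite ym /=.
have md := mmin d syd.
rewrite ltnNge leq_eqVlt (inj_eq val_inj) (inj_eq perm_inj).
apply/negP => /orP[/eqP xm | /amin]; last lia.
by move: md; rewrite -xm; lia.
Qed.

Lemma split_avoids n (s : 'S_n) :
  (forall i, lr_max s i -> initiates_descent s i) ->
  inversions_split s -> avoids_bar3_bar1_542 s.
Proof.
move=> desc /inversions_splitP spl; apply/avoidsP => a b c ab bc sba scb.
have nmb : ~~ lr_max s b by apply/negP => /lr_maxP/(_ a ab); lia.
have [m' mm' /andP[cm' m'b]] := spl b c bc scb nmb.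
have [m [cm mm mmin]] := first_above cm'.
have mm'_le := mmin m' cm'.
have smm' := lr_max_mono mm' mm'_le.
(* The barred 3 is [m], the earliest entry above [s c], with [s m <= s m' < s b]. If [a <= m],
   monotonicity along maxima would give [s a <= s m < s b]. *)
have ma : m < a.
  rewrite ltnNge; apply/negP => am.
  have := lr_max_mono mm am; lia.
have /existsP[e /andP[/eqP em sem]] := desc m mm.
have ea : e < a.
  rewrite ltn_neqAle em ma andbT -em; apply/eqP => /val_inj ea.
  by move: sem; rewrite ea; lia.
exists m, e; split; try lia.
(* If the entry [e] after [m] exceeded [s c], then [e] and [c] would form an inversion, split by a
   maximum with value between [s c] and [s e < s m]. No maximum lies there, since [m] comes first
   among entries above [s c]. *)
rewrite ltnNge; apply/negP => sce.
have nec : c != e by apply/eqP => ce; move: em ab bc; rewrite -ce; lia.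
have {}sce : s c < s e by have := perm_ltn_neq s nec; lia.
have nme : ~~ lr_max s e by apply/negP => /lr_maxP/(_ m); lia.
have ec : e < c by lia.
have [k mk /andP[ck ke]] := spl e c ec sce nme.
have := lr_max_mono mk (mmin k ck); lia.
Qed.

(** * Appending a last entry: left-to-right maxima and split inversions *)

Section InsertLast.

Variables (n : nat) (v : 'I_n.+1) (s : 'S_n).
Let t := lift_perm ord_max v s.

Lemma ltn_lift (k l : 'I_n) : (lift v k < lift v l) = (k < l).
Proof. by rewrite /= !ltnNge leq_bump2. Qed.

Lemma lift_last_lt (x : 'I_n) : lift ord_max x < (ord_max : 'I_n.+1).
Proof. by rewrite lift_max. Qed.

Lemma lr_max_lift_last : lr_max t ord_max = (v == ord_max).
Proof.
rewrite /t; apply/lr_maxP/eqP => [|-> h]; rewrite lift_perm_id.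
  move=> H.
  apply/eqP; apply: contraT => vn.
  have vlt : v < n.
    by have := ltn_ord v; rewrite -(inj_eq val_inj) /= in vn; lia.
  (* The entry of [s] with value [v] is shifted to [v+1], so it beats the new last entry. *)
  have := H (lift ord_max ((s^-1)%g (Ordinal vlt))) (lift_last_lt _).
  by rewrite lift_perm_lift permKV /= /bump leqnn; lia.
case: (unliftP ord_max h) => [k -> _|->]; last lia.
by rewrite lift_perm_lift lift_last_lt.
Qed.

Lemma lr_max_lift (x : 'I_n) : lr_max t (lift ord_max x) = lr_max s x.
Proof.
apply/lr_maxP/lr_maxP => H h; rewrite /t.
  move=> hx; have := H (lift ord_max h); rewrite /t !lift_perm_lift !ltn_lift.
  by rewrite !lift_max; apply.
rewrite !lift_perm_lift; case: (unliftP ord_max h) => [k ->|-> /=]; last first.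
  by rewrite /bump; have := ltn_ord x; lia.
by rewrite lift_perm_lift !lift_max ltn_lift; exact: H.
Qed.

Lemma card_lr_max_lift :
  #|[set i | lr_max t i]| = #|[set i | lr_max s i]| + (v == ord_max).
Proof.
rewrite -!sum1dep_card !big_mkcond big_ord_recr /=; congr (_ + _).
  rewrite [RHS]big_mkcond; apply: eq_bigr => i _; rewrite -lr_max_lift.
  suff -> : widen_ord (leqnSn n) i = lift ord_max i by [].
  by apply: val_inj; rewrite /= /bump leqNgt ltn_ord.
by rewrite lr_max_lift_last; case: (_ == _).
Qed.

(** Membership in the image means that [v] equals some [s m] as a number. The appending shifts that
    maximum to [v+1], so the new entry sits just below it. *)
Lemma inversions_split_lift :
  inversions_split t = inversions_split s &&
    ((v == ord_max) ||
     (v \in [set lift ord_max (s m) | m in [set i | lr_max s i]])).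
Proof.
apply/idP/andP => [/inversions_splitP spl | [/inversions_splitP spl vP]].
- split.
  + apply/inversions_splitP => x y xy syx nmx.
    have [|||] := spl (lift ord_max x) (lift ord_max y);
      rewrite ?lr_max_lift //.
    * by rewrite !lift_max.
    * by rewrite /t !lift_perm_lift ltn_lift.
    move=> m; case: (unliftP ord_max m) => [k ->|->].
      by rewrite lr_max_lift /t !lift_perm_lift !ltn_lift; exists k.
    rewrite lr_max_lift_last => /eqP vn.
    rewrite /t !lift_perm_lift lift_perm_id vn lift_max /=.
    by have := ltn_ord (s x); rewrite /bump; lia.
  + case: eqVneq => //= vn.
    case: (unliftP ord_max v) => [w vw|/eqP]; last by rewrite (negbTE vn).
    have vwE : v = w :> nat by rewrite vw lift_max.
    (* The entry shifted from [v] to [v+1] forms an inversion with the new last entry, and no value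
       lies between them. It must therefore be a left-to-right maximum. *)
    rewrite vw; apply/imsetP; exists ((s^-1)%g w); rewrite ?permKV // inE.
    apply: contraT => nm.
    have [|||] := spl (lift ord_max ((s^-1)%g w)) ord_max;
      rewrite ?lr_max_lift //.
    * exact: lift_last_lt.
    * by rewrite /t lift_perm_id lift_perm_lift permKV /= /bump vwE leqnn.
    move=> m; case: (unliftP ord_max m) => [k ->|-> _]; last by rewrite ltnn.
    rewrite lr_max_lift /t lift_perm_id !lift_perm_lift permKV ltn_lift => _.
    by rewrite /= /bump vwE => /andP[vk kw]; move: vk;
      rewrite (leqNgt w) kw add0n ltnNge (ltnW kw).
- apply/inversions_splitP => x y xy syx.
  case: (unliftP ord_max x) xy syx => [x' ->|->] xy; last first.
    by have := ltn_ord y; move: xy => /=; lia.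
  rewrite lr_max_lift; case: (unliftP ord_max y) xy => [y' ->|->] xy.
    rewrite /t !lift_perm_lift !ltn_lift => syx nmx.
    have [|||m mm /andP[ym mx]] := spl x' y' => //.
      by rewrite !lift_max in xy.
    exists (lift ord_max m); rewrite ?lr_max_lift //.
    by rewrite lift_perm_lift !ltn_lift ym.
  rewrite /t lift_perm_lift lift_perm_id => syx nmx.
  case/orP: vP => [/eqP vn|/imsetP[m]].
    by move: syx; rewrite {1 2}vn lift_max /= ; have := ltn_ord (s x'); lia.
  rewrite inE => mm vm; exists (lift ord_max m); rewrite ?lr_max_lift //.
  rewrite lift_perm_lift ltn_lift.
  (* An inversion ending at the new entry starts at a value above [v]. Not starting at [m], it
     starts above [v+1] and is split by [m]. *)
  have nmx' : m != x' by apply/eqP => mx; rewrite mx (negbTE nmx) in mm.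
  have := perm_ltn_neq s nmx'.
  have vE : v = s m :> nat by rewrite vm lift_max.
  by move: syx; rewrite /= /bump vE leqnn; case: leqP => //; lia.
Qed.

End InsertLast.

(** * Descents at left-to-right maxima under appending *)

Definition last_lr_max n (s : 'S_n) : bool :=
  [exists i : 'I_n, (i.+1 == n) && lr_max s i].

Definition inner_descents n (s : 'S_n) : bool :=
  [forall i : 'I_n,
     lr_max s i ==> ((i.+1 == n) || initiates_descent s i)].

Lemma all_descentsE n (s : 'S_n) :
  [forall i : 'I_n, lr_max s i ==> initiates_descent s i] =
  inner_descents s && ~~ last_lr_max s.
Proof.
apply/forallP/andP => [H | [/forallP H nl] i].
  split.
    by apply/forallP => i; apply/implyP => /(implyP (H i)) ->; rewrite orbT.
  apply/negP => /existsP[i /andP[/eqP il /(implyP (H i))]].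
  case/existsP=> k /andP[/eqP ki _].
  by have := ltn_ord k; rewrite ki il ltnn.
apply/implyP => mi; have /orP[il|//] := implyP (H i) mi.
by case/negP: nl; apply/existsP; exists i; rewrite il mi.
Qed.

Section InsertLastDescents.

Variables (n : nat) (v : 'I_n.+1) (s : 'S_n).
Let t := lift_perm ord_max v s.

Lemma last_lr_max_lift : last_lr_max t = (v == ord_max).
Proof.
rewrite -(lr_max_lift_last v s); apply/existsP/idP => [[i /andP[/eqP[il]]]|H].
  by have -> : i = ord_max by apply: val_inj.
by exists ord_max; rewrite eqxx.
Qed.

(** Only the old last position gains a successor. The bound [v <= s x] is not strict because values
    from [v] upward are raised by one. *)
Lemma initiates_descent_lift (x : 'I_n) :
  initiates_descent t (lift ord_max x) =
  initiates_descent s x || ((x.+1 == n) && (v <= s x)).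
Proof.
rewrite /initiates_descent /t; apply/existsP/orP => [[k]|].
  case: (unliftP ord_max k) => [l ->|->].
    rewrite !lift_perm_lift ltn_lift !lift_max => H.
    by left; apply/existsP; exists l.
  rewrite lift_perm_lift lift_perm_id lift_max eq_sym => /andP[-> H].
  by right; move: H; rewrite /= /bump; case: leqP => //; lia.
case=> [/existsP[l H]|/andP[/eqP xn vx]].
  by exists (lift ord_max l); rewrite !lift_perm_lift ltn_lift !lift_max.
exists ord_max; rewrite lift_perm_lift lift_perm_id lift_max /= xn eqxx /=.
by rewrite /bump vx.
Qed.

Lemma inner_descents_lift :
  inner_descents t = inner_descents s && (last_lr_max s ==> (v != ord_max)).
Proof.
apply/forallP/andP => [H | [/forallP H vl] x].
  split.
    apply/forallP => x; apply/implyP => mx.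
    have := implyP (H (lift ord_max x)).
    rewrite lr_max_lift initiates_descent_lift lift_max eqSS => /(_ mx).
    case/or3P=> [/eqP xn|->|/andP[-> _] //]; last by rewrite orbT.
    by have := ltn_ord x; lia.
  apply/implyP => /existsP[x /andP[/eqP xn mx]].
  have := implyP (H (lift ord_max x)).
  rewrite lr_max_lift initiates_descent_lift lift_max eqSS => /(_ mx).
  apply: contraTneq => ->.
  have -> : (x == n :> nat) = false by lia.
  rewrite /= [n <= _]leqNgt ltn_ord andbF orbF.
  by apply/negP => /existsP[k /andP[/eqP ki _]]; have := ltn_ord k;
    rewrite ki xn ltnn.
apply/implyP; case: (unliftP ord_max x) => [y ->|->] /=; last by rewrite eqxx.
rewrite lr_max_lift initiates_descent_lift => my.
have /orP[yn|->] := implyP (H y) my; last by rewrite orbT.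
have vn : v != ord_max.
  by apply: (implyP vl); apply/existsP; exists y; rewrite yn my.
case: (unliftP ord_max v) vn => [w vw _|->]; last by rewrite eqxx.
rewrite yn; suff -> : v <= s y by rewrite !orbT.
(* A maximum in the last position of [s] has the largest value, so any [v] other than the top
   creates a descent after it. *)
rewrite vw lift_max -(permKV s w); apply: lr_max_mono => //.
by have := ltn_ord ((s^-1)%g w); lia.
Qed.

End InsertLastDescents.

(** * The recurrence for the permutation counts *)

Lemma card_perm_insert_last n (Q : pred 'S_n.+1) :
  #|[set t | Q t]| = \sum_(s : 'S_n) #|[set v | Q (lift_perm ord_max v s)]|.
Proof.
under eq_bigr do rewrite -sum1dep_card.
rewrite -sum1dep_card pair_big_dep /=.
rewrite (reindex (fun p : 'S_n * 'I_n.+1 => lift_perm ord_max p.2 p.1)) //=.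
(* Injectivity suffices, since both sides have cardinality [(n+1)!]. *)
apply/onW_bij/inj_card_bij => [[s v] [s' v'] /= E|]; last first.
  by rewrite card_prod !card_Sn card_ord factS mulnC.
have vv' : v = v' by rewrite -(lift_perm_id ord_max v s) E lift_perm_id.
congr (_, _) => //; apply/permP => x.
have := congr1 (fun r : 'S_n.+1 => r (lift ord_max x)) E.
by rewrite !lift_perm_lift vv' => /lift_inj.
Qed.

Definition split_perm n j (s : 'S_n) : bool :=
  [&& inversions_split s, #|[set i | lr_max s i]| == j & inner_descents s].

(* [inner_descents] ignores the last position, so [num_inner] counts the
   permutations of the theorem, while [num_last] counts those whose last entry
   is a left-to-right maximum that still awaits its descent. *)
Definition num_inner n j :=
  #|[set s : 'S_n | split_perm j s && ~~ last_lr_max s]|.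
Definition num_last n j :=
  #|[set s : 'S_n | split_perm j s && last_lr_max s]|.

(** Each [s] satisfying [split_perm j] has exactly [j] admissible non-top last values, one below
    each maximum. Any of them also supplies the descent that a final maximum of [s] lacks. *)
Lemma num_innerS n j : num_inner n.+1 j = j * (num_inner n j + num_last n j).
Proof.
rewrite /num_inner card_perm_insert_last.
transitivity (\sum_(s : 'S_n | split_perm j s) j); last first.
  rewrite sum_nat_const mulnC; congr (_ * _).
  transitivity #|[set s : 'S_n | split_perm j s]|; first by rewrite cardsE.
  rewrite -(cardsID [set s : 'S_n | last_lr_max s] [set s | split_perm j s]).
  rewrite addnC; congr (_ + _); apply: eq_card => s; rewrite !inE //.
  exact: andbC.
rewrite [RHS]big_mkcond; apply: eq_bigr => s _.
case: ifP => [/and3P[spl /eqP <- desc]|nspl].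
  pose f m := lift ord_max (s m).
  have f_inj : injective f by move=> x y /lift_inj/perm_inj.
  rewrite -[RHS](card_imset _ f_inj); apply: eq_card => v.
  rewrite !inE /split_perm inversions_split_lift card_lr_max_lift.
  rewrite inner_descents_lift last_lr_max_lift spl desc.
  case: (eqVneq v ord_max) => [->|vn] /=.
    rewrite !andbF; apply/esym/negbTE/imsetP => -[m _ /eqP].
    by rewrite (negbTE (neq_lift _ _)).
  by rewrite addn0 eqxx implybT !andbT.
apply/eqP; rewrite cards_eq0; apply/eqP/setP => v; rewrite !inE.
apply: contraFF nspl.
rewrite /split_perm inversions_split_lift card_lr_max_lift inner_descents_lift.
rewrite last_lr_max_lift; case: eqP => [_|]; rewrite ?andbF //= addn0.
by move=> _ /andP[/and4P[/andP[-> _] -> -> _] _].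
Qed.

(** The appended entry must be the top value. This adds one maximum and denies a descent to the
    preceding entry, which therefore cannot be a maximum. *)
Lemma num_lastS n j : num_last n.+1 j.+1 = num_inner n j.
Proof.
rewrite /num_last /num_inner card_perm_insert_last -sum1dep_card.
rewrite [RHS]big_mkcond.
apply: eq_bigr => s _.
have -> : [set v | split_perm j.+1 (lift_perm ord_max v s) &&
                    last_lr_max (lift_perm ord_max v s)] =
          [set v | (v == ord_max) && (split_perm j s && ~~ last_lr_max s)].
  apply/setP => v; rewrite !inE /split_perm inversions_split_lift.
  rewrite card_lr_max_lift inner_descents_lift last_lr_max_lift.
  case: eqP => //= _; last by rewrite andbF.
  rewrite addn1 eqSS implybF !andbT.
  by case: inversions_split; case: inner_descents; rewrite ?andbF ?andbT //=.
case: ifP => H.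
  rewrite -(cards1 (ord_max : 'I_n.+1)); apply: eq_card => v.
  by rewrite !inE andbT.
by apply/eqP; rewrite cards_eq0; apply/eqP/setP => v; rewrite !inE andbF.
Qed.

Lemma num_inner0 j : num_inner 0 j = (j == 0).
Proof.
rewrite /num_inner; case: j => [|j].
  transitivity #|{: 'S_0}|; last by rewrite card_Sn.
  apply: eq_card => s; rewrite !inE.
  rewrite /split_perm /inversions_split /inner_descents /last_lr_max.
  apply/andP; split; [apply/and3P; split|]; first by apply/forallP => -[].
  - by rewrite cards_eq0; apply/eqP/setP => -[].
  - by apply/forallP => -[].
  - by apply/existsP => -[[]].
apply/eqP; rewrite cards_eq0; apply/eqP/setP => s; rewrite !inE /split_perm.
have -> : [set i | lr_max s i] = set0 by apply/setP => -[].
by rewrite cards0 andbF.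
Qed.

Lemma num_last0 j : num_last 0 j = 0.
Proof.
apply/eqP; rewrite cards_eq0; apply/eqP/setP => s; rewrite !inE.
by rewrite [last_lr_max s](_ : _ = false) ?andbF //; apply/existsP => -[[]].
Qed.

Lemma num_innerSS n j :
  num_inner n.+2 j.+1 = j.+1 * (num_inner n.+1 j.+1 + num_inner n j).
Proof. by rewrite num_innerS num_lastS. Qed.

(** * Set partitions and the Stirling recurrence *)

Section StirlingRecurrence.

Variable T : finType.
Implicit Types (D B : {set T}) (P Q : {set {set T}}).

(** Partitions of subsets of one fixed type, so that an element can be removed from [D] without
    changing the type. *)
Definition partitions_of D j : {set {set {set T}}} :=
  [set P | partition P D & #|P| == j].

Lemma partition_eq D P B B' x :
  partition P D -> B \in P -> B' \in P -> x \in B -> x \in B' -> B = B'.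
Proof.
move=> /partition_trivIset triv BP B'P xB xB'.
by rewrite -(def_pblock triv BP xB) (def_pblock triv B'P xB').
Qed.

Lemma partitionNmem D P B x :
  partition P D -> x \notin D -> B \in P -> x \notin B.
Proof.
by move=> pP xD BP; apply: contra xD; apply: subsetP (partitionS pP BP) x.
Qed.

Lemma card_partitions_singleton D x j : x \notin D ->
  #|[set P in partitions_of (x |: D) j.+1 | [set x] \in P]| =
  #|partitions_of D j|.
Proof.
move=> xD.
have xN Q : partition Q D -> [set x] \notin Q.
  by move=> pQ; apply/negP => /(partitionNmem pQ xD); rewrite inE eqxx.
have inj : {in partitions_of D j &, injective (fun Q => [set x] |: Q)}.
  move=> Q Q'; rewrite !inE => /andP[pQ _] /andP[pQ' _] E.
  by rewrite -(setU1K (xN _ pQ)) E setU1K ?xN.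
rewrite -(card_in_imset inj); apply: eq_card => P; rewrite !inE.
apply/idP/imsetP => [/andP[/andP[pP /eqP cP] xP]|[Q]].
  exists (P :\ [set x]); last by rewrite setD1K.
  rewrite inE -eqSS -cP (cardsD1 [set x] P) xP eqxx andbT.
  by have := partitionD1 pP xP; rewrite setU1K.
rewrite inE => /andP[pQ /eqP cQ] ->.
rewrite setU11 cardsU1 xN // cQ eqxx !andbT.
apply: partitionU1 => //; first by apply/set0Pn; exists x; rewrite inE.
by rewrite disjoints1.
Qed.

Lemma partition_insert D x Q B : x \notin D -> partition Q D -> B \in Q ->
  partition ((x |: B) |: (Q :\ B)) (x |: D).
Proof.
move=> xD pQ BQ; have BD := partitionS pQ BQ.
have -> : x |: D = (x |: B) :|: (D :\: B).
  by rewrite -setUA -{1}(setID D B) (setIidPr BD).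
apply: partitionU1; first exact: partitionD1.
  by apply/set0Pn; exists x; rewrite setU11.
rewrite -setI_eq0; apply/eqP/setP => y; rewrite !inE.
by case: eqP => [->|_] /=; [rewrite (negbTE xD) andbF | case: (y \in B)].
Qed.

(** Such partitions correspond to pairs of a partition of [D] and one of its [j] blocks, the one
    that receives [x]. *)
Lemma card_partitions_grow D x j : x \notin D ->
  #|[set P in partitions_of (x |: D) j | [set x] \notin P]| =
  j * #|partitions_of D j|.
Proof.
move=> xD.
pose S :=
  [set p : {set {set T}} * {set T} | p.1 \in partitions_of D j & p.2 \in p.1].
pose f (p : {set {set T}} * {set T}) := (x |: p.2) |: (p.1 :\ p.2).
have -> : j * #|partitions_of D j| = #|S|.
  rewrite mulnC -sum_nat_const -[RHS]sum1dep_card.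
  rewrite -(pair_big_dep _ (fun Q B => B \in Q) (fun _ _ => 1)) /=.
  by apply: eq_bigr => Q; rewrite inE sum1_card => /andP[_ /eqP].
have xB Q B : partition Q D -> B \in Q -> x \notin B.
  by move=> pQ; exact: partitionNmem pQ xD.
have nmem Q B : partition Q D -> x |: B \notin Q.
  by move=> pQ; apply/negP => /(partitionNmem pQ xD); rewrite setU11.
have inj : {in S &, injective f}.
  move=> [Q B] [Q' B']; rewrite !inE /=.
  move=> /andP[/andP[pQ _] BQ] /andP[/andP[pQ' _] BQ'].
  rewrite /f /= => E.
  (* The enlarged block is recovered as the block of the image containing [x]. *)
  have xBB' : x |: B = x |: B'.
    apply: (partition_eq (partition_insert xD pQ BQ) (x := x));
      rewrite ?setU11 //.
    by rewrite E setU11.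
  have BB' : B = B' by rewrite -(setU1K (xB _ _ pQ BQ)) xBB' setU1K ?(xB Q').
  move: E BQ'; rewrite -BB' => E BQ'.
  congr (_, _); rewrite -(setD1K BQ) -(setD1K BQ').
  have nm Q0 : partition Q0 D -> x |: B \notin Q0 :\ B.
    by move=> pQ0; rewrite inE (negbTE (nmem _ _ pQ0)) andbF.
  congr (_ |: _).
  by rewrite -(setU1K (nm _ pQ)) E setU1K ?nm.
rewrite -(card_in_imset inj); apply: eq_card => P; rewrite !inE.
apply/idP/imsetP => [/andP[/andP[pP /eqP cP] nx]|[[Q B]]]; last first.
  rewrite !inE /= => /andP[/andP[pQ /eqP cQ] BQ] ->; rewrite /f /=.
  rewrite partition_insert //= cardsU1 inE (negbTE (nmem _ _ pQ)) andbF /=.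
  move: cQ; rewrite (cardsD1 B Q) BQ => ->; rewrite eqxx /= !inE.
  apply/negP => /orP[/eqP E|/andP[_ /(xB _ _ pQ)]]; last by rewrite inE eqxx.
  have /set0Pn[y yB] := partition_neq0 pQ BQ.
  have : y \in [set x] by rewrite E !inE yB orbT.
  by rewrite inE => /eqP yx; move: (xB _ _ pQ BQ); rewrite -yx yB.
have xP : x \in cover P by rewrite (cover_partition pP) setU11.
have triv := partition_trivIset pP.
pose C := pblock P x.
have CP : C \in P by rewrite pblock_mem.
have xC : x \in C by rewrite mem_pblock.
have pPC := partitionD1 pP CP.
have CD : C \subset x |: D := partitionS pP CP.
(* The inverse map deletes [x] from its block [C]; what remains is nonempty because [[set x]] is not
   a block. *)
have Cx0 : C :\ x != set0.
  apply: contra nx => /eqP C0.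
  by rewrite -[[set x]]setU0 -C0 setD1K.
have DE : (C :\ x) :|: ((x |: D) :\: C) = D.
  apply/setP => y; rewrite !inE; have := subsetP CD y; rewrite !inE.
  case: (eqVneq y x) => [->|_] /=; first by rewrite xC (negbTE xD).
  by case: (y \in C) => //= ->.
have CxP : C :\ x \notin P :\ C.
  have /set0Pn[y yC] := Cx0.
  apply/negP => /setD1P[/eqP ne CxP]; apply: ne.
  apply: (partition_eq pP CxP CP yC).
  by case/setD1P: yC.
exists ((C :\ x) |: (P :\ C), C :\ x); last by rewrite /f /= setU1K // !setD1K.
rewrite !inE /= eqxx andbT cardsU1 CxP -cP (cardsD1 C P) CP eqxx andbT.
rewrite -[X in partition _ X]DE; apply: partitionU1 => //.
rewrite -setI_eq0; apply/eqP/setP => y; rewrite !inE.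
by case: (y \in C); rewrite ?andbF.
Qed.

Lemma card_partitionsS D x j : x \notin D ->
  #|partitions_of (x |: D) j.+1| =
  j.+1 * #|partitions_of D j.+1| + #|partitions_of D j|.
Proof.
move=> xD; rewrite -(card_partitions_singleton j xD).
rewrite -(card_partitions_grow j.+1 xD).
rewrite -(cardsID [set P : {set {set T}} | [set x] \in P]) addnC.
by congr (_ + _); apply: eq_card => P; rewrite !inE // andbC.
Qed.

Lemma card_partitions0 D : D != set0 -> #|partitions_of D 0| = 0.
Proof.
move=> D0; apply/eqP; rewrite cards_eq0; apply/eqP/setP => P; rewrite !inE.
apply: contraNF D0 => /andP[/cover_partition <-]; rewrite cards_eq0 => /eqP ->.
by rewrite /cover big_set0.
Qed.

Lemma card_partitions_set0 j : #|partitions_of set0 j| = (j == 0).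
Proof.
case: j => [|j].
  transitivity #|[set set0 : {set {set T}}]|; last by rewrite cards1.
  apply: eq_card => P.
  by rewrite !inE partition_set0 cards_eq0 andbb.
apply/eqP; rewrite cards_eq0; apply/eqP/setP => P; rewrite !inE partition_set0.
by case: eqP => // ->; rewrite cards0.
Qed.

Fixpoint stirling2_rec (m j : nat) : nat :=
  match m, j with
  | 0, 0 => 1
  | m'.+1, j'.+1 => j'.+1 * stirling2_rec m' j'.+1 + stirling2_rec m' j'
  | _, _ => 0
  end.

Lemma card_partitions_of D j : #|partitions_of D j| = stirling2_rec #|D| j.
Proof.
move: {2}#|D| (erefl #|D|) => m; elim: m D j => [|m IH] D j.
  move=> D0; rewrite D0; move/eqP: D0; rewrite cards_eq0 => /eqP ->.
  by rewrite card_partitions_set0; case: j.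
move=> Dm; have /card_gt0P[x xD] : 0 < #|D| by rewrite Dm.
rewrite Dm; case: j => [|j] /=.
  by rewrite card_partitions0 // -card_gt0 Dm.
have Dxm : #|D :\ x| = m by move: Dm; rewrite (cardsD1 x D) xD => -[].
by rewrite -(setD1K xD) card_partitionsS ?setD11 // !IH // Dxm.
Qed.

End StirlingRecurrence.

(** * Solving the recurrence and concluding *)

Lemma stirling2E m j : stirling2 m%:Z j = stirling2_rec m j.
Proof. by rewrite -[in RHS](card_ord m) -cardsT -card_partitions_of. Qed.

Lemma num_innerE n j :
  num_inner n j = if j <= n then j`! * stirling2_rec (n - j) j else 0.
Proof.
(* The recurrence reaches back two sizes, hence strong induction with base cases 0 and 1. *)
have [m] := ubnP n; elim: m n j => // m IH [|[|n]] j nm.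
- by rewrite num_inner0; case: j.
- rewrite num_innerS num_inner0 num_last0.
  by case: j => [|[|j]] //; rewrite muln0.
case: j => [|j]; first by rewrite num_innerS mul0n mul1n.
rewrite num_innerSS !IH; [|lia..].
(* For [j < n.+1] this is the Stirling recurrence times [j.+1] factorial. At [j = n.+1] the upper
   index is 0 with a positive number of blocks, so both sides vanish. *)
rewrite !ltnS subSS; case: (ltngtP j n.+1) => [jn|jn|->].
- by rewrite -ltnS jn subSn //= factS subSS; lia.
- by rewrite leqNgt ltnW //= muln0.
- by rewrite ltnn subnn addn0 /= !muln0.
Qed.

Theorem theorem2 (n j : nat) :
  #|[set pi : 'S_n |
       [&& avoids_bar3_bar1_542 pi,
           #|[set i : 'I_n | lr_max pi i]| == j
         & [forall i : 'I_n, lr_max pi i ==> initiates_descent pi i]]]|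
  = j`! * stirling2 (n%:Z - j%:Z)%R j.
Proof.
transitivity (num_inner n j).
  apply: eq_card => s; rewrite !inE /split_perm -!andbA -all_descentsE.
  case: (boolP [forall i, _]) => [/forallP H|_]; rewrite ?andbF // !andbT.
  congr (_ && _); apply/idP/idP => [/avoids_split //|]; apply: split_avoids.
  by move=> i; apply/implyP.
rewrite num_innerE; case: leqP => [jn|nj].
  by rewrite -stirling2E subzn.
(* For [j > n] the upper index is negative, where [stirling2] is 0 by convention. *)
have -> : (n%:Z - j%:Z)%R = Negz (j - n).-1 by lia.
by rewrite muln0.
Qed.
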